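(* Let $\boldsymbol S=\boldsymbol\Theta\boldsymbol\Theta^T+\boldsymbol W$ be as in the context (MAXBET model). Suppose $m> \|\boldsymbol W\|(4\sqrt r+1)+1$ and $$m > 4m\,\frac{2\left(\max_{1\le i\le m}\|[\boldsymbol W\boldsymbol\Theta]_i\|_F+4\|\boldsymbol W\|^2\sqrt{\tfrac rm}\right)}{m-\|\boldsymbol W\|(4\sqrt r+1)-1}+2\left(\max_{1\le i\le m}\|[\boldsymbol W\boldsymbol\Theta]_i\|_F+4\|\boldsymbol W\|^2\sqrt{\tfrac rm}\right)+8\|\boldsymbol W\|\sqrt{\tfrac rm}+2\|\boldsymbol W\|.$$ Then (OTSM) and (SDP) are equivalent in the sense that every solution $\hat{\boldsymbol U}$ of (SDP) is also a solution of the rank-constrained problem (R).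
   Context: Let $m,r\ge1$ and $d_1,\dots,d_m$ be integers with $r\le\min_i d_i$, and $D=\sum_{i=1}^m d_i$. $\mathcal O_{d,r}=\{\boldsymbol O\in\mathbb R^{d\times r}:\boldsymbol O^T\boldsymbol O=\mathbf I_r\}$. A $D\times D$ matrix $\boldsymbol X$ is partitioned into blocks $\boldsymbol X_{ij}\in\mathbb R^{d_i\times d_j}$, and a $D\times r$ matrix $\boldsymbol Y$ into blocks $\boldsymbol Y_i=[\boldsymbol Y]_i\in\mathbb R^{d_i\times r}$. $\|\cdot\|$ is the operator norm, $\|\cdot\|_F$ the Frobenius norm, and $\preccurlyeq,\succcurlyeq$ denote the positive semidefinite order. MAXBET model: $\boldsymbol\Theta_i\in\mathcal O_{d_i,r}$ for $i=1,\dots,m$, $\boldsymbol\Theta\in\mathbb R^{D\times r}$ is the matrix with blocks $\boldsymbol\Theta_i$, $\boldsymbol W\in\mathbb R^{D\times D}$ is symmetric, and $\boldsymbol S_{ij}=\boldsymbol\Theta_i\boldsymbol\Theta_j^T+\boldsymbol W_{ij}$ for all $1\le i,j\le m$, i.e. $\boldsymbol S=\boldsymbol\Theta\boldsymbol\Theta^T+\boldsymbol W$. (OTSM): maximize $\sum_{i,j=1}^m\mathrm{tr}(\boldsymbol O_i^T\boldsymbol S_{ij}\boldsymbol O_j)$ subject to $\boldsymbol O_i\in\mathcal O_{d_i,r}$, $i=1,\dots,m$. With $\boldsymbol U=\boldsymbol O\boldsymbol O^T$ it is equivalent to (R): maximize $\mathrm{tr}(\boldsymbol S\boldsymbol U)$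 over symmetric $\boldsymbol U\in\mathbb R^{D\times D}$ subject to $\boldsymbol U\succcurlyeq 0$, $\mathrm{rank}(\boldsymbol U)=r$, $\boldsymbol U_{ii}\preccurlyeq\mathbf I$ and $\mathrm{tr}(\boldsymbol U_{ii})=r$ for all $i$. (SDP): maximize $\mathrm{tr}(\boldsymbol S\boldsymbol U)$ over symmetric $\boldsymbol U\in\mathbb R^{D\times D}$ subject to $\boldsymbol U\succcurlyeq0$, $\boldsymbol U_{ii}\preccurlyeq\mathbf I$ and $\mathrm{tr}(\boldsymbol U_{ii})=r$ for all $i$. *)

(* Defs.v *)
From mathcomp Require Import all_boot all_order all_algebra.
From mathcomp Require Import all_classical all_reals.

Set Implicit Arguments.
Unset Strict Implicit.
Unset Printing Implicit Defensive.

Import Order.TTheory GRing.Theory Num.Theory.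

Local Open Scope classical_set_scope.
Local Open Scope ring_scope.

Definition frobenius (R : realType) (p q : nat) (A : 'M[R]_(p, q)) : R :=
  Num.sqrt (\sum_(i < p) \sum_(j < q) A i j ^+ 2).

(* On a column vector the Frobenius norm is the Euclidean norm.  The supremum
   is over a nonempty set (take x = 0), bounded by [frobenius A]. *)
Definition opnorm (R : realType) (p q : nat) (A : 'M[R]_(p, q)) : R :=
  sup [set frobenius (A *m x) | x in [set x : 'cV[R]_q | frobenius x <= 1]].

Definition psd (R : realType) (n : nat) (A : 'M[R]_n) : Prop :=
  A^T = A /\ forall x : 'cV[R]_n, 0 <= (x^T *m A *m x) 0 0.

Definition loewner_le (R : realType) (n : nat) (A B : 'M[R]_n) : Prop :=
  psd (B - A).

Definition stiefel (R : realType) (p r : nat) : set 'M[R]_(p, r) :=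
  [set O | O^T *m O = 1%:M].

Definition maximizer (R : realType) (T : Type) (F : set T) (f : T -> R) :
  set T := [set x | F x /\ forall y, F y -> f y <= f x].

(* Symmetry of U is part of [psd]. *)
Definition sdp_feasible (R : realType) (m : nat) (d : 'I_m -> nat) (r : nat) :
    set 'M[R]_(\sum_(i < m) d i) :=
  [set U | psd U /\
     forall i : 'I_m, loewner_le (submxblock U i i) 1%:M /\
                      \tr (submxblock U i i) = r%:R].

Definition rank_feasible (R : realType) (m : nat) (d : 'I_m -> nat)
    (r : nat) : set 'M[R]_(\sum_(i < m) d i) :=
  [set U | sdp_feasible r U /\ \rank U = r].

Definition sdp_solution (R : realType) (m : nat) (d : 'I_m -> nat) (r : nat)
    (S : 'M[R]_(\sum_(i < m) d i)) : set 'M[R]_(\sum_(i < m) d i) :=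
  maximizer (@sdp_feasible R m d r) (fun U => \tr (S *m U)).

Definition rank_solution (R : realType) (m : nat) (d : 'I_m -> nat) (r : nat)
    (S : 'M[R]_(\sum_(i < m) d i)) : set 'M[R]_(\sum_(i < m) d i) :=
  maximizer (@rank_feasible R m d r) (fun U => \tr (S *m U)).

(* max_i ||[Y]_i||_F; the default value 0 is harmless for m >= 1 since the
   norms are nonnegative. *)
Definition max_block_frobenius (R : realType) (m : nat) (d : 'I_m -> nat)
    (r : nat) (Y : 'M[R]_(\sum_(i < m) d i, r)) : R :=
  \big[Num.max/0]_(i < m) frobenius (submxcol Y i).

(* Main.v *)
Require Import Defs.
From mathcomp Require Import all_boot all_order all_algebra.
From mathcomp Require Import all_classical all_reals.
From mathcomp Require Import topology normedtype derive.
From mathcomp Require Import ring lra.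

(** The relaxation is tight because the global maximiser of the nonconvex
    problem carries a strict dual certificate.

    Among the global maximisers [O] of [tr (O^T S O)] over tuples of Stiefel
    blocks (they exist by compactness), choose one for which [tr (Theta^T O)] is
    largest; then [P = Theta^T O] is positive semidefinite
    ([aligned_maximizer_exists]).  Comparing the objective at [O] and [Theta]
    gives [|O - Theta|_F <= 4 |W| sqrt (r / m)] ([aligned_global_error]).

    Maximality of [O] along rotations of one block yields
    [(S O)_i = O_i Lambda_i] with [Lambda_i] symmetric ([multiplier_sym]), and
    maximality along reflections yields [Lambda_i >= O_i^T S_ii O_i >= - |W|]
    ([multiplier_ge], [diagonal_block_ge]).  As also
    [(S O)_i = Theta_i P + (W O)_i], the blocks [O_i] and [Theta_i] are polar
    factors of two nearby matrices, and the perturbation bound for polar factors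
    ([polar_perturbation]) gives [|O_i - Theta_i|_F <= a], where [a] is the
    fraction in the second hypothesis.  This improves the bound on the
    multipliers to [Lambda_i >= t] with [t] close to [m]
    ([multiplier_lower_bound]).

    The dual slack matrix is
    [K = diag (O_i Lambda_i O_i^T + t (1 - O_i O_i^T)) - S].  It satisfies
    [K O = 0], and on the orthogonal of the range of [O] it is at least
    [t - |O - Theta|_F^2 - |W|], which is positive by the second hypothesis
    ([certificate_margin]).  Complementary slackness then confines the range of
    any solution [U] of the relaxation to that of [O], and the block constraints
    leave only [U = O O^T] ([dual_certificate]), which has rank [r]. *)

Set Implicit Arguments.
Unset Strict Implicit.
Unset Printing Implicit Defensive.

Import Order.TTheory GRing.Theory Num.Theory.
Import numFieldNormedType.Exports.

Local Open Scope classical_set_scope.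
Local Open Scope ring_scope.

(** * Frobenius inner product, Frobenius norm and operator norm *)

Section FrobeniusInnerProduct.
Context {R : realType}.

Definition mxdot p q (A B : 'M[R]_(p, q)) : R := \tr (A^T *m B).

Lemma mxdotE p q (A B : 'M[R]_(p, q)) :
  mxdot A B = \sum_(i < p) \sum_(j < q) A i j * B i j.
Proof.
rewrite /mxdot /mxtrace exchange_big /=.
by apply: eq_bigr => i _; rewrite mxE; apply: eq_bigr => j _; rewrite mxE.
Qed.

Lemma mxdotC p q (A B : 'M[R]_(p, q)) : mxdot A B = mxdot B A.
Proof. by rewrite /mxdot -mxtrace_tr trmx_mul trmxK. Qed.

Lemma mxdotDl p q (A B C : 'M[R]_(p, q)) :
  mxdot (A + B) C = mxdot A C + mxdot B C.
Proof. by rewrite /mxdot linearD mulmxDl linearD. Qed.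

Lemma mxdotDr p q (A B C : 'M[R]_(p, q)) :
  mxdot C (A + B) = mxdot C A + mxdot C B.
Proof. by rewrite /mxdot mulmxDr linearD. Qed.

Lemma mxdotZl p q a (A B : 'M[R]_(p, q)) : mxdot (a *: A) B = a * mxdot A B.
Proof. by rewrite /mxdot linearZ -scalemxAl linearZ. Qed.

Lemma mxdotZr p q a (A B : 'M[R]_(p, q)) : mxdot A (a *: B) = a * mxdot A B.
Proof. by rewrite /mxdot -scalemxAr linearZ. Qed.

Lemma mxdotNl p q (A B : 'M[R]_(p, q)) : mxdot (- A) B = - mxdot A B.
Proof. by rewrite -scaleN1r mxdotZl mulN1r. Qed.

Lemma mxdotNr p q (A B : 'M[R]_(p, q)) : mxdot A (- B) = - mxdot A B.
Proof. by rewrite -scaleN1r mxdotZr mulN1r. Qed.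

Lemma mxdotBl p q (A B C : 'M[R]_(p, q)) :
  mxdot (A - B) C = mxdot A C - mxdot B C.
Proof. by rewrite mxdotDl mxdotNl. Qed.

Lemma mxdotBr p q (A B C : 'M[R]_(p, q)) :
  mxdot C (A - B) = mxdot C A - mxdot C B.
Proof. by rewrite mxdotDr mxdotNr. Qed.

Lemma mxdot_sumr p q (I : finType) (F : I -> 'M[R]_(p, q)) A :
  mxdot A (\sum_i F i) = \sum_i mxdot A (F i).
Proof. by rewrite /mxdot mulmx_sumr linear_sum. Qed.

Lemma mxdot_mull p q s (A : 'M[R]_(p, q)) (B : 'M[R]_(q, s)) C :
  mxdot (A *m B) C = mxdot B (A^T *m C).
Proof. by rewrite /mxdot trmx_mul mulmxA. Qed.

Lemma mxdot_mulr p q s (A : 'M[R]_(p, q)) (B : 'M[R]_(q, s)) C :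
  mxdot (A *m B) C = mxdot A (C *m B^T).
Proof. by rewrite /mxdot trmx_mul -mulmxA mxtrace_mulC mulmxA. Qed.

Lemma mxdot_tr p q (A B : 'M[R]_(p, q)) : mxdot A^T B^T = mxdot A B.
Proof. by rewrite mxdotC /mxdot trmxK mxtrace_mulC. Qed.

Lemma mxdot_ge0 p q (A : 'M[R]_(p, q)) : 0 <= mxdot A A.
Proof.
rewrite mxdotE; apply: sumr_ge0 => i _; apply: sumr_ge0 => j _.
exact: sqr_ge0.
Qed.

Lemma mxdot_eq0 p q (A : 'M[R]_(p, q)) : mxdot A A = 0 -> A = 0.
Proof.
rewrite mxdotE => /eqP; rewrite psumr_eq0 => [/allP A0|i _]; last first.
  by apply: sumr_ge0 => j _; exact: sqr_ge0.
apply/matrixP => i j; rewrite mxE; have := A0 i (mem_index_enum i) => /=.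
rewrite psumr_eq0 => [/allP/(_ j (mem_index_enum j))|k _]; last exact: sqr_ge0.
by rewrite /= mulf_eq0 orbb => /eqP.
Qed.

Lemma mxdot_cv p (x y : 'cV[R]_p) : mxdot x y = (x^T *m y) 0 0.
Proof. by rewrite /mxdot /mxtrace big_ord1. Qed.

Lemma frobeniusE p q (A : 'M[R]_(p, q)) : frobenius A = Num.sqrt (mxdot A A).
Proof. by rewrite mxdotE. Qed.

Lemma frobenius_ge0 p q (A : 'M[R]_(p, q)) : 0 <= frobenius A.
Proof. exact: sqrtr_ge0. Qed.

Lemma frobenius_sqr p q (A : 'M[R]_(p, q)) : frobenius A ^+ 2 = mxdot A A.
Proof. by rewrite frobeniusE sqr_sqrtr // mxdot_ge0. Qed.

Lemma frobenius0 p q : frobenius (0 : 'M[R]_(p, q)) = 0.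
Proof. by rewrite frobeniusE /mxdot mulmx0 mxtrace0 sqrtr0. Qed.

Lemma frobenius_eq0 p q (A : 'M[R]_(p, q)) : frobenius A = 0 -> A = 0.
Proof. by move=> A0; apply: mxdot_eq0; rewrite -frobenius_sqr A0 expr0n. Qed.

Lemma frobeniusZ p q a (A : 'M[R]_(p, q)) :
  frobenius (a *: A) = `|a| * frobenius A.
Proof.
by rewrite !frobeniusE mxdotZl mxdotZr mulrA -expr2 sqrtrM ?sqr_ge0// sqrtr_sqr.
Qed.

Lemma frobeniusN p q (A : 'M[R]_(p, q)) : frobenius (- A) = frobenius A.
Proof. by rewrite -scaleN1r frobeniusZ normrN1 mul1r. Qed.

Lemma frobenius_tr p q (A : 'M[R]_(p, q)) : frobenius A^T = frobenius A.
Proof. by rewrite !frobeniusE mxdot_tr. Qed.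

Lemma frobenius_le p q (A : 'M[R]_(p, q)) c :
  0 <= c -> mxdot A A <= c ^+ 2 -> frobenius A <= c.
Proof.
by move=> c0; rewrite -frobenius_sqr ler_pXn2r ?nnegrE ?frobenius_ge0.
Qed.

Lemma norm_le_frobenius p q (A : 'M[R]_(p, q)) i j : `|A i j| <= frobenius A.
Proof.
rewrite -(@ler_pXn2r _ 2) ?nnegrE ?frobenius_ge0// frobenius_sqr mxdotE.
rewrite (bigD1 i)//= (bigD1 j)//= real_normK ?num_real// expr2 -addrA lerDl.
rewrite addr_ge0// ?sumr_ge0// => [k _|k _]; first exact: sqr_ge0.
by apply: sumr_ge0 => l _; exact: sqr_ge0.
Qed.

Lemma mxdot_le p q (A B : 'M[R]_(p, q)) :
  mxdot A B <= frobenius A * frobenius B.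
Proof.
have [A0|A0] := eqVneq (frobenius A) 0.
  by rewrite A0 mul0r (frobenius_eq0 A0) /mxdot trmx0 mul0mx mxtrace0.
have [B0|B0] := eqVneq (frobenius B) 0.
  by rewrite B0 mulr0 (frobenius_eq0 B0) /mxdot mulmx0 mxtrace0.
have Agt0 : 0 < frobenius A by rewrite lt_def A0 frobenius_ge0.
have Bgt0 : 0 < frobenius B by rewrite lt_def B0 frobenius_ge0.
have := mxdot_ge0 (frobenius B *: A - frobenius A *: B).
rewrite mxdotBl !mxdotBr !mxdotZl !mxdotZr (mxdotC B A) -!frobenius_sqr => h.
have AB := mulr_gt0 Agt0 Bgt0.
rewrite -(ler_pM2l AB); nra.
Qed.

Lemma mxdot_ge p q (A B : 'M[R]_(p, q)) :
  - (frobenius A * frobenius B) <= mxdot A B.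
Proof. by rewrite -lerN2 opprK -mxdotNl -(frobeniusN A) mxdot_le. Qed.

Lemma frobeniusD p q (A B : 'M[R]_(p, q)) :
  frobenius (A + B) <= frobenius A + frobenius B.
Proof.
apply: frobenius_le; first by rewrite addr_ge0 ?frobenius_ge0.
rewrite mxdotDl !mxdotDr (mxdotC B A) -!frobenius_sqr.
have := mxdot_le A B; nra.
Qed.

Lemma mxdot_col p q (A B : 'M[R]_(p, q)) :
  mxdot A B = \sum_j mxdot (col j A) (col j B).
Proof.
rewrite mxdotE exchange_big; apply: eq_bigr => j _; rewrite mxdotE.
by apply: eq_bigr => i _; rewrite big_ord1 !mxE.
Qed.

(** Cauchy--Schwarz, row by row and column by column. *)
Lemma frobeniusM p q s (A : 'M[R]_(p, q)) (B : 'M[R]_(q, s)) :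
  frobenius (A *m B) <= frobenius A * frobenius B.
Proof.
apply: frobenius_le; first by rewrite mulr_ge0 ?frobenius_ge0.
have rows : mxdot A A = \sum_i mxdot (row i A) (row i A).
  rewrite -mxdot_tr mxdot_col; apply: eq_bigr => i _.
  by rewrite -tr_row mxdot_tr.
rewrite exprMn !frobenius_sqr rows (mxdot_col B) mxdotE big_distrl /=.
apply: ler_sum => i _; rewrite big_distrr /=; apply: ler_sum => j _.
have -> : (A *m B) i j = mxdot (row i A)^T (col j B).
  by rewrite mxdot_cv trmxK -row_mul !mxE; apply: eq_bigr => k _; rewrite !mxE.
set x := _^T.
have -> : mxdot (row i A) (row i A) = mxdot x x by rewrite mxdot_tr.
rewrite -!frobenius_sqr.
have := mxdot_le x (col j B); have := mxdot_ge x (col j B); nra.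
Qed.

(** The unit ball contains [x / |x|], so the supremum controls [A x] by
    homogeneity; [frobenius A] bounds the set, so the supremum is genuine. *)
Lemma frobenius_opnorm_cv p q (A : 'M[R]_(p, q)) (x : 'cV[R]_q) :
  frobenius (A *m x) <= opnorm A * frobenius x.
Proof.
have [x0|x0] := eqVneq (frobenius x) 0.
  by rewrite x0 mulr0 (frobenius_eq0 x0) mulmx0 frobenius0.
have xgt0 : 0 < frobenius x by rewrite lt_def x0 frobenius_ge0.
rewrite -ler_pdivrMr// mulrC.
have -> : (frobenius x)^-1 * frobenius (A *m x)
    = frobenius (A *m ((frobenius x)^-1 *: x)).
  by rewrite -scalemxAr frobeniusZ ger0_norm// invr_ge0 ltW.
apply: ub_le_sup; last first.
  exists ((frobenius x)^-1 *: x) => //=.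
  by rewrite frobeniusZ ger0_norm ?mulVf// invr_ge0 ltW.
exists (frobenius A) => _ [y y1 <-]; apply: (le_trans (frobeniusM _ _)).
by rewrite ler_piMr ?frobenius_ge0.
Qed.

Lemma opnorm_ge0 p q (A : 'M[R]_(p, q)) : 0 <= opnorm A.
Proof.
apply: ub_le_sup; last by exists 0 => /=; rewrite ?mulmx0 frobenius0.
exists (frobenius A) => _ [y y1 <-]; apply: (le_trans (frobeniusM _ _)).
by rewrite ler_piMr ?frobenius_ge0.
Qed.

Lemma frobenius_opnorm p q s (A : 'M[R]_(p, q)) (B : 'M[R]_(q, s)) :
  frobenius (A *m B) <= opnorm A * frobenius B.
Proof.
apply: frobenius_le; first by rewrite mulr_ge0 ?opnorm_ge0 ?frobenius_ge0.
rewrite exprMn frobenius_sqr mxdot_col (mxdot_col B) big_distrr /=.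
apply: ler_sum => j _; rewrite -!frobenius_sqr -exprMn.
have -> : col j (A *m B) = A *m col j B by rewrite !colE mulmxA.
rewrite ler_pXn2r ?nnegrE ?mulr_ge0 ?opnorm_ge0 ?frobenius_ge0//.
exact: frobenius_opnorm_cv.
Qed.

Lemma opnorm_quad_le p (A : 'M[R]_p) (x : 'cV[R]_p) :
  mxdot x (A *m x) <= opnorm A * mxdot x x.
Proof.
apply: le_trans (mxdot_le _ _) _; rewrite -frobenius_sqr expr2 mulrCA.
by rewrite ler_wpM2l ?frobenius_ge0 ?frobenius_opnorm.
Qed.

Lemma opnorm_quad_ge p (A : 'M[R]_p) (x : 'cV[R]_p) :
  - (opnorm A * mxdot x x) <= mxdot x (A *m x).
Proof.
apply: le_trans (mxdot_ge _ _); rewrite lerN2 -frobenius_sqr expr2 mulrCA.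
by rewrite ler_wpM2l ?frobenius_ge0 ?frobenius_opnorm.
Qed.

End FrobeniusInnerProduct.

(** * Positive semidefinite matrices *)

Section PositiveSemidefinite.
Context {R : realType}.

Lemma psdP n (A : 'M[R]_n) :
  psd A <-> A^T = A /\ forall x : 'cV[R]_n, 0 <= mxdot x (A *m x).
Proof.
by split=> -[symA A0]; split=> // x; have := A0 x; rewrite mxdot_cv mulmxA.
Qed.

Lemma psd_gram p q (B : 'M[R]_(p, q)) : psd (B^T *m B).
Proof.
apply/psdP; split; first by rewrite trmx_mul trmxK.
by move=> x; rewrite -mulmxA mxdotC mxdot_mull trmxK mxdot_ge0.
Qed.

Lemma psd_congr p q (A : 'M[R]_p) (B : 'M[R]_(p, q)) :
  psd A -> psd (B^T *m A *m B).
Proof.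
move=> /psdP[symA A0]; apply/psdP; split.
  by rewrite !trmx_mul trmxK symA mulmxA.
by move=> x; rewrite -!mulmxA mxdotC mxdot_mull trmxK mxdotC A0.
Qed.

Lemma psdZ n a (A : 'M[R]_n) : 0 <= a -> psd A -> psd (a *: A).
Proof.
move=> a0 /psdP[symA A0]; apply/psdP; split; first by rewrite linearZ /= symA.
by move=> x; rewrite -scalemxAl mxdotZr mulr_ge0.
Qed.

Lemma psd_scalar n c (A : 'M[R]_n) : A^T = A ->
  (forall x : 'cV[R]_n, c * mxdot x x <= mxdot x (A *m x)) -> psd (A - c%:M).
Proof.
move=> symA Ac; apply/psdP; split; first by rewrite linearB /= symA tr_scalar_mx.
by move=> x; rewrite mulmxBl mul_scalar_mx mxdotBr mxdotZr subr_ge0.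
Qed.

Lemma discriminant_le0 (a b c : R) :
  (forall t, 0 <= a + 2 * t * b + t ^+ 2 * c) -> b ^+ 2 <= a * c.
Proof.
move=> h; have a0 : 0 <= a by have := h 0; rewrite !(mulr0, mul0r, expr0n, addr0).
have [c0|c0|c0] := ltrgt0P c.
- have := h (- b / c).
  have -> : a + 2 * (- b / c) * b + (- b / c) ^+ 2 * c = (a * c - b ^+ 2) / c.
    by field; rewrite gt_eqF.
  by rewrite pmulr_lge0 ?invr_gt0// subr_ge0.
- exfalso; pose u := (a + 1) / - c.
  have u0 : 0 <= u by rewrite divr_ge0 ?oppr_ge0 ?(ltW c0)// addr_ge0.
  have uc : u * c = - (a + 1) by rewrite /u; field; rewrite lt_eqF.
  have := h (1 + u); have := h (- (1 + u)); nra.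
- rewrite c0 mulr0; have [->|b0] := eqVneq b 0; first by rewrite expr0n.
  exfalso; have := h (- (a + 1) / (2 * b)); rewrite c0.
  have -> : a + 2 * (- (a + 1) / (2 * b)) * b + (- (a + 1) / (2 * b)) ^+ 2 * 0 = -1.
    by field.
  by rewrite oppr_ge0 ler10.
Qed.

Lemma psd_cauchy n (A : 'M[R]_n) (x y : 'cV[R]_n) : psd A ->
  mxdot x (A *m y) ^+ 2 <= mxdot x (A *m x) * mxdot y (A *m y).
Proof.
move=> /psdP[symA A0]; apply: discriminant_le0 => t.
have := A0 (x + t *: y); rewrite mulmxDr -scalemxAr mxdotDl !mxdotDr.
rewrite !mxdotZl !mxdotZr.
have -> : mxdot y (A *m x) = mxdot x (A *m y).
  by rewrite mxdotC mxdot_mull symA.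
move=> h; apply: (le_trans h); rewrite le_eqVlt; apply/orP; left.
by apply/eqP; ring.
Qed.

Lemma psd_null n (A : 'M[R]_n) (x : 'cV[R]_n) :
  psd A -> mxdot x (A *m x) = 0 -> A *m x = 0.
Proof.
move=> psdA x0; have [symA _] := psdA; apply: mxdot_eq0.
have := psd_cauchy x (A *m x) psdA; rewrite x0 mul0r.
have -> : mxdot x (A *m (A *m x)) = mxdot (A *m x) (A *m x).
  by rewrite [RHS]mxdot_mull symA.
move=> h; apply/eqP; rewrite -sqrf_eq0; apply/eqP; apply: le_anti.
by rewrite h sqr_ge0.
Qed.

Lemma diag_quad n (A : 'M[R]_n) k :
  A k k = mxdot (delta_mx k 0 : 'cV_n) (A *m delta_mx k 0).
Proof. by rewrite mxdot_cv -colE trmx_delta -rowE !mxE. Qed.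

Lemma psd_diag_ge0 n (A : 'M[R]_n) k : psd A -> 0 <= A k k.
Proof. by move=> /psdP[_ A0]; rewrite diag_quad. Qed.

Lemma psd_diag0 n (A : 'M[R]_n) k j : psd A -> A k k = 0 -> A j k = 0.
Proof.
move=> psdA; rewrite diag_quad => /(psd_null psdA); rewrite -colE.
by move=> /matrixP/(_ j 0); rewrite !mxE.
Qed.

Lemma psd_trace0 n (A : 'M[R]_n) : psd A -> \tr A = 0 -> A = 0.
Proof.
move=> psdA /eqP; rewrite psumr_eq0 => [/allP A0|k _]; last exact: psd_diag_ge0.
apply/matrixP => j k; rewrite mxE; apply: (psd_diag0 _ psdA).
exact/eqP/(A0 k (mem_index_enum k)).
Qed.

(** Subtracting the rank-one matrix built on the column of a nonzero pivot
    [A k k] is one step of the Cholesky factorisation: Cauchy--Schwarz for the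
    form [A] keeps the remainder positive semidefinite, the pivot disappears
    and no new diagonal entry shows up.  Peeling off all pivots turns the trace
    into a sum of values of the form [B]. *)
Lemma psd_tr_mul_ge0 n (A B : 'M[R]_n) : psd A -> psd B -> 0 <= \tr (A *m B).
Proof.
move=> + psdB; move: {2}#|_| (leqnn #|[pred k | A k k != 0]|) => s.
elim: s A => [|s IHs] A sA psdA.
  suff -> : A = 0 by rewrite mul0mx mxtrace0.
  apply/matrixP => j k; rewrite mxE; apply: (psd_diag0 _ psdA); apply/eqP.
  move: sA; rewrite leqn0 => /eqP/card0_eq/(_ k).
  by rewrite !inE => /negbFE.
have [[k Ak]|noA] := pselect (exists k, A k k != 0); last first.
  apply: IHs => //; rewrite eq_card0// => k.
  by rewrite !inE; apply/negbTE/negP => Ak; apply: noA; exists k.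
have Ak0 : 0 < A k k by rewrite lt_def Ak psd_diag_ge0.
have [symA _] := psdA; set c := col k A.
pose A' := A - (A k k)^-1 *: (c *m c^T).
have psdA' : psd A'.
  apply/psdP; split.
    by rewrite linearB linearZ /= trmx_mul trmxK symA.
  move=> x; rewrite mulmxBl -scalemxAl mxdotBr mxdotZr subr_ge0 mulrC.
  rewrite ler_pdivrMr// [X in _ * X]diag_quad; apply: le_trans (psd_cauchy _ _ psdA).
  rewrite -colE -/c -mulmxA mxdotC mxdot_mull mxdotC expr2.
  have -> : mxdot x c = (c^T *m x) 0 0 by rewrite mxdotC mxdot_cv.
  by rewrite mxdotE !big_ord1.
have -> : A = A' + (A k k)^-1 *: (c *m c^T) by rewrite /A' subrK.
rewrite mulmxDl linearD -scalemxAl linearZ /= addr_ge0//; last first.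
  rewrite mulr_ge0 ?invr_ge0 ?(ltW Ak0)// -mulmxA mxtrace_mulC -mulmxA.
  by move/psdP: psdB => [_ B0]; have := B0 c; rewrite /mxdot.
apply: IHs => //; rewrite -ltnS; apply: leq_trans sA; apply: proper_card.
apply/properP; split.
  apply/fintype.subsetP => j; rewrite !inE; apply: contraNneq => Aj.
  rewrite !mxE big_ord1 !mxE Aj.
  have -> : A j k = A k j by rewrite -{1}symA mxE.
  by rewrite (psd_diag0 _ psdA Aj) mul0r mulr0 subr0.
exists k; rewrite !inE // negbK !mxE big_ord1 !mxE.
by rewrite mulKf// subrr.
Qed.

Lemma psd_tr_mul_le n (T A B : 'M[R]_n) :
  psd T -> loewner_le A B -> \tr (T *m A) <= \tr (T *m B).
Proof.
move=> psdT AB; rewrite -subr_ge0 -linearB /= -mulmxBr; exact: psd_tr_mul_ge0.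
Qed.

End PositiveSemidefinite.

(** * Compactness and continuity for matrices *)

Section Compactness.
Context {R : realType}.

Lemma vec_mx_continuous n q : continuous (@vec_mx R n q).
Proof.
move=> v A /nbhs_ballP[e e0 eA]; apply/nbhs_ballP; exists e => // w [_ vw].
by apply: eA; split=> // i j; rewrite !mxE; exact: vw.
Qed.

Lemma continuous_sumr (T : topologicalType) (I : finType) (F : I -> T -> R) :
  (forall i, continuous (F i)) -> continuous (fun x => \sum_i F i x).
Proof.
by move=> cF; apply: continuous_big => //; exact: add_continuous.
Qed.

Lemma mxdot_continuous n q p s (f g : 'M[R]_(n, q) -> 'M[R]_(p, s)) :
  (forall i j, continuous (fun X => f X i j)) ->
  (forall i j, continuous (fun X => g X i j)) ->
  continuous (fun X => mxdot (f X) (g X)).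
Proof.
move=> cf cg; under eq_fun do rewrite mxdotE.
apply: continuous_sumr => i; apply: continuous_sumr => j X.
by apply: continuousM; [exact: cf | exact: cg].
Qed.

Lemma mulmx_entry_continuous n q p s t
    (f : 'M[R]_(n, q) -> 'M[R]_(p, s)) (g : 'M[R]_(n, q) -> 'M[R]_(s, t)) :
  (forall i j, continuous (fun X => f X i j)) ->
  (forall i j, continuous (fun X => g X i j)) ->
  forall i j, continuous (fun X => (f X *m g X) i j).
Proof.
move=> cf cg i j; under eq_fun do rewrite mxE.
by apply: continuous_sumr => k X; apply: continuousM; [exact: cf | exact: cg].
Qed.

(** Flattening matrices to row vectors embeds [F] as a closed subset of a
    product of segments, which is compact. *)
Lemma matrix_max_attained n q c (F : set 'M[R]_(n, q)) (f : 'M[R]_(n, q) -> R) :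
  closed F -> (forall X, F X -> frobenius X <= c) ->
  continuous f -> F !=set0 -> exists X, maximizer F f X.
Proof.
move=> clF bndF cf [X0 FX0].
pose A : set 'rV[R]_(n * q) := vec_mx @^-1` F.
have cA : compact A.
  have box := @rV_compact R _ (fun=> `[- c, c]%classic)
    (fun=> @segment_compact R (- c) c).
  apply: (subclosed_compact _ (box (n * q)%N)) => [|v Av i].
    by apply: preimage_closed => // ? _; exact: vec_mx_continuous.
  rewrite /= in_itv /= -ler_norml.
  case/mxvec_indexP: i => i j; apply: le_trans (bndF _ Av).
  by apply: le_trans (norm_le_frobenius _ i j); rewrite mxE.
have A0 : A !=set0.
  by exists (mxvec X0); rewrite /A /= mxvecK.
have cfA : {within A, continuous (f \o vec_mx)}.
  apply: continuous_subspaceT => v; apply: continuous_comp; last exact: cf.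
  exact: vec_mx_continuous.
have [v] := compact_EVT_max A0 cA cfA.
rewrite inE => Av vmax; exists (vec_mx v); split => // Y FY.
by have := vmax (mxvec Y); rewrite /= mxvecK; apply; rewrite inE /A /= mxvecK.
Qed.

End Compactness.

(** * Maxima over the orthogonal group *)

Section OrthogonalStationarity.
Context {R : realType}.

Lemma linear_term_le0 (a b : R) :
  (forall t, 0 < t <= 1 -> a <= t * b) -> a <= 0.
Proof.
move=> h; rewrite leNgt; apply/negP => a0.
pose M := 1 + `|b|; have M1 : 1 <= M by rewrite /M lerDl.
have aM : 0 < a + M by lra.
have t0 : 0 < a / (a + M) by rewrite divr_gt0.
have := h (a / (a + M)).
rewrite t0 ler_pdivrMr// mul1r lerDl (le_trans ler01 M1) => /(_ isT).
rewrite mulrAC ler_pdivlMr// ler_pM2l//.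
by have := ler_norm b; rewrite /M; lra.
Qed.

(** Orthogonal matrices [1 + K] near the identity are supplied by the plane
    rotations through the coordinates [a] and [b], parametrised rationally by
    [t = tan (angle / 2)]: there [K = s J - h P] where [J] is the generator,
    [P = - J ^ 2] the projection on the plane, [s] the sine and [h = s t] one
    minus the cosine.  As [t] tends to 0, the quadratic part of the functional
    becomes negligible and the sign of the first-order term
    [mxdot J C = C a b - C b a] is forced; exchanging [a] and [b] gives the
    opposite sign. *)
Lemma rotation_stationary_sym n (C A B : 'M[R]_n) :
  (forall K : 'M[R]_n, (1%:M + K)^T *m (1%:M + K) = 1%:M ->
     mxdot K C + mxdot K (A *m K *m B) <= 0) ->
  C^T = C.
Proof.
move=> stat.
suff le_C a b : C a b <= C b a.
  by apply/matrixP => a b; rewrite mxE; apply/le_anti; rewrite !le_C.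
have [->//|nab] := eqVneq a b.
pose J : 'M[R]_n := delta_mx a b - delta_mx b a.
pose P : 'M[R]_n := delta_mx a a + delta_mx b b.
have JT : J^T = - J by rewrite linearB /= !trmx_delta opprB.
have PT : P^T = P by rewrite linearD /= !trmx_delta.
have dl (i j k l : 'I_n) : delta_mx i j *m delta_mx k l =
    if j == k then delta_mx i l else 0 :> 'M[R]_n.
  by rewrite mul_delta_mx_cond; case: eqP.
have nba : (b == a) = false by rewrite eq_sym (negbTE nab).
have JJ : J *m J = - P.
  rewrite mulmxBl !mulmxBr !dl !eqxx (negbTE nab) nba /P.
  by rewrite sub0r subr0 opprD addrC.
have JP : J *m P = J.
  by rewrite mulmxBl !mulmxDr !dl !eqxx (negbTE nab) nba add0r addr0.
have PJ : P *m J = J.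
  by rewrite mulmxDl !mulmxBr !dl !eqxx (negbTE nab) nba subr0 sub0r.
have PP : P *m P = P.
  by rewrite mulmxDl !mulmxDr !dl !eqxx (negbTE nab) nba addr0 add0r.
have JC : mxdot J C = C a b - C b a.
  have dC i j : mxdot (delta_mx i j) C = C i j.
    rewrite mxdotE (bigD1 i)//= [X in _ + X]big1 ?addr0 => [|k ki].
      rewrite (bigD1 j)//= big1 ?addr0 => [|k kj].
        by rewrite mxE !eqxx mul1r.
      by rewrite mxE (negbTE kj) andbF mul0r.
    by apply: big1 => l _; rewrite mxE (negbTE ki) mul0r.
  by rewrite mxdotBl !dC.
rewrite -subr_le0 -JC.
pose be := mxdot P C; pose ga := mxdot J (A *m J *m B).
pose de := mxdot J (A *m P *m B) + mxdot P (A *m J *m B).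
pose et := mxdot P (A *m P *m B).
apply: (@linear_term_le0 _ (`|be| + 2 * (`|ga| + `|de| + `|et|))) => t.
move=> /andP[t0 t1].
have t2 : 0 < 1 + t ^+ 2 by rewrite ltr_wpDr ?sqr_ge0.
pose s := 2 * t / (1 + t ^+ 2); pose h := s * t.
have s0 : 0 < s by rewrite divr_gt0// mulr_gt0.
have s2 : s <= 2 * t by rewrite ler_pdivrMr//; nra.
have sh : s ^+ 2 + h ^+ 2 = 2 * h by rewrite /h /s; field; rewrite gt_eqF.
pose K := s *: J - h *: P.
have Korth : (1%:M + K)^T *m (1%:M + K) = 1%:M.
  have KT : K^T = - (s *: J) - h *: P.
    by rewrite /K linearB !linearZ /= JT PT scalerN.
  have KK : K^T *m K = (s ^+ 2 + h ^+ 2) *: P.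
    rewrite KT /K mulmxBl !mulmxBr !mulNmx -!scalemxAl -!scalemxAr.
    rewrite JJ JP PJ PP !scalerA.
    by apply/matrixP => i j; rewrite !mxE; ring.
  rewrite [X in X *m _]linearD /= trmx1 mulmxDl mul1mx mulmxDr mulmx1 KK sh KT /K.
  by apply/matrixP => i j; rewrite !mxE; ring.
have := stat K Korth; rewrite /K mulmxBr mulmxBl -!scalemxAr -!scalemxAl.
rewrite !mxdotBl !mxdotBr !mxdotZl !mxdotZr -/be -/ga -/et => le0.
have {}le0 : s * mxdot J C <=
    s * (t * be - s * ga + s * t * de - s * t ^+ 2 * et).
  rewrite -subr_le0; apply: le_trans le0; rewrite le_eqVlt; apply/orP; left.
  by apply/eqP; rewrite /de /h; ring.
rewrite ler_pM2l// in le0; rewrite -mxdotBl; apply: (le_trans le0).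
have bnd u x : 0 <= u <= 2 * t ->
    u * x <= 2 * t * `|x| /\ - (u * x) <= 2 * t * `|x|.
  move=> /andP[u0 ut]; have xa := ler_norm x; have xb := ler_norm (- x).
  rewrite normrN in xb; have := normr_ge0 x; split; nra.
have [_ h1] := bnd s ga ltac:(by rewrite (ltW s0) s2).
have [h2 _] := bnd (s * t) de ltac:(by apply/andP; split; nra).
have [_ h3] := bnd (s * t ^+ 2) et ltac:(by apply/andP; split; nra).
have h4 : t * be <= t * `|be| by rewrite ler_pM2l// ler_norm.
lra.
Qed.

Lemma householder_orthogonal n (c : R) (v : 'cV[R]_n) : c * mxdot v v = 2 ->
  (1%:M + - c *: (v *m v^T))^T *m (1%:M + - c *: (v *m v^T)) = 1%:M.
Proof.
move=> cv; rewrite [X in X *m _]linearD linearZ /= trmx1 trmx_mul trmxK.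
rewrite mulmxDl mul1mx mulmxDr mulmx1 -scalemxAl -scalemxAr.
have -> : v *m v^T *m (v *m v^T) = mxdot v v *: (v *m v^T).
  rewrite mulmxA -(mulmxA v) (mx11_scalar (v^T *m v)) -mxdot_cv mul_mx_scalar.
  by rewrite -scalemxAl.
have -> : - c *: (- c *: (mxdot v v *: (v *m v^T))) = (2 * c) *: (v *m v^T).
  by rewrite !scalerA -cv; congr (_ *: _); ring.
rewrite -addrA -!scalerDl (_ : - c + _ = 0) ?scale0r ?addr0//; ring.
Qed.

Lemma mxdot_rank1 n (C : 'M[R]_n) (v : 'cV[R]_n) :
  mxdot (v *m v^T) C = mxdot v (C *m v).
Proof. by rewrite mxdot_mulr trmxK. Qed.

(** Rotations make [C] symmetric, and the reflection along [v] changes the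
    functional by a negative multiple of [mxdot v (C v)]. *)
Lemma orthogonal_max_psd n (C : 'M[R]_n) :
  (forall Q : 'M[R]_n, Q^T *m Q = 1%:M -> mxdot C Q <= mxdot C 1%:M) -> psd C.
Proof.
move=> Cmax.
have C0 K : (1%:M + K)^T *m (1%:M + K) = 1%:M -> mxdot K C <= 0.
  by move=> /Cmax; rewrite mxdotDr gerDl mxdotC.
apply/psdP; split.
  apply: (@rotation_stationary_sym _ C 0 0) => K /C0.
  by rewrite mulmx0 [X in _ + X]mxdotC /mxdot trmx0 mul0mx mxtrace0 addr0.
move=> v; have [v0|v0] := eqVneq (mxdot v v) 0.
  by rewrite (mxdot_eq0 v0) mulmx0 mxdot_ge0.
have vgt0 : 0 < mxdot v v by rewrite lt_def v0 mxdot_ge0.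
have := C0 _ (householder_orthogonal (divfK v0 2)).
by rewrite mxdotZl mxdot_rank1 mulNr oppr_le0 pmulr_rge0// divr_gt0.
Qed.

End OrthogonalStationarity.

(** * Block structure and optimality conditions *)

Section StiefelProducts.
Context {R : realType}.

Lemma stiefelM p q s (A : 'M[R]_(p, q)) (B : 'M[R]_(q, s)) :
  stiefel A -> stiefel B -> stiefel (A *m B).
Proof.
by move=> AA BB; rewrite /stiefel /= trmx_mul -mulmxA (mulmxA A^T) AA mul1mx.
Qed.

Lemma stiefel_stationary p q (O B : 'M[R]_(p, q)) :
  stiefel O -> (B *m O^T)^T = B *m O^T ->
  (O^T *m B)^T = O^T *m B /\ B = O *m (O^T *m B).
Proof.
move=> stO; rewrite !trmx_mul !trmxK => sym.
have BE : B = O *m B^T *m O by rewrite sym -mulmxA stO mulmx1.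
have LT : O^T *m B = B^T *m O by rewrite [in LHS]BE !mulmxA stO mul1mx.
by split; rewrite LT // mulmxA.
Qed.

End StiefelProducts.

Section BlockSelection.
Context {R : realType} {m : nat} {d : 'I_m -> nat}.
Local Notation N := (\sum_(i < m) d i)%N.

(** Multiplying by this matrix on the left selects the [i]-th block of rows;
    block identities thus become plain matrix identities, free of casts between
    block sizes. *)
Definition block_sel (i : 'I_m) : 'M[R]_(d i, N) := submxcol 1%:M i.

Lemma block_selE q (Y : 'M[R]_(N, q)) i : block_sel i *m Y = submxcol Y i.
Proof. by rewrite submxcol_mul mul1mx. Qed.

Lemma block_sel_congr (A : 'M[R]_N) i j :
  block_sel i *m A *m (block_sel j)^T = submxblock A i j.
Proof.
rewrite block_selE submxblockEv; apply: trmx_inj.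
by rewrite trmx_mul trmxK block_selE tr_submxrow.
Qed.

Lemma block_sel_id i : block_sel i *m (block_sel i)^T = 1%:M.
Proof.
rewrite -[X in X *m _]mulmx1 block_sel_congr; apply/matrixP => a b.
by rewrite !mxE -val_eqE tagnat.eq_Rank eqxx.
Qed.

Lemma block_sel_orth i j : i != j -> block_sel i *m (block_sel j)^T = 0.
Proof.
move=> nij; rewrite -[X in X *m _]mulmx1 block_sel_congr; apply/matrixP => a b.
by rewrite !mxE -val_eqE tagnat.eq_Rank (negbTE nij).
Qed.

Lemma block_sel_sum : \sum_i (block_sel i)^T *m block_sel i = 1%:M.
Proof.
rewrite -[RHS]mulmx1 -{1}(submxrowK 1%:M) -(submxcolK (1%:M : 'M_N)).
rewrite mul_mxrow_mxcol; apply: eq_bigr => i _.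
by rewrite /block_sel tr_submxcol trmx1 submxcolK.
Qed.

Lemma mxdot_blocks q (X Y : 'M[R]_(N, q)) :
  mxdot X Y = \sum_i mxdot (block_sel i *m X) (block_sel i *m Y).
Proof.
rewrite -[Y in LHS]mul1mx -block_sel_sum mulmx_suml mxdot_sumr.
by apply: eq_bigr => i _; rewrite mxdot_mull mulmxA.
Qed.

Lemma frobenius_block_le q (Y : 'M[R]_(N, q)) i :
  frobenius (block_sel i *m Y) <= frobenius Y.
Proof.
apply: frobenius_le; rewrite ?frobenius_ge0// frobenius_sqr (mxdot_blocks Y).
by rewrite [leRHS](bigD1 i)//= lerDl sumr_ge0// => j _; exact: mxdot_ge0.
Qed.

Definition block_stiefel r : set 'M[R]_(N, r) :=
  [set O | forall i, stiefel (block_sel i *m O)].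

Lemma block_stiefel_gram r (O : 'M[R]_(N, r)) :
  block_stiefel O -> O^T *m O = m%:R%:M.
Proof.
move=> stO; rewrite -[O in X in _ *m X]mul1mx -block_sel_sum mulmx_suml.
rewrite mulmx_sumr (eq_bigr (fun=> 1%:M)) => [|i _].
  by rewrite sumr_const card_ord -scaler_nat scalemx1.
by rewrite -mulmxA mulmxA -trmx_mul stO.
Qed.

Lemma block_stiefel_mxdot r (O : 'M[R]_(N, r)) :
  block_stiefel O -> mxdot O O = m%:R * r%:R.
Proof.
by move/block_stiefel_gram => OO; rewrite /mxdot OO mxtrace_scalar mulr_natr.
Qed.

Lemma block_stiefel_mulr r (O : 'M[R]_(N, r)) (Q : 'M[R]_r) :
  stiefel Q -> block_stiefel O -> block_stiefel (O *m Q).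
Proof.
by move=> QQ stO i; rewrite mulmxA; apply: stiefelM.
Qed.

Lemma block_sel_update r (O : 'M[R]_(N, r)) i (X : 'M[R]_(d i, r)) :
  block_stiefel O -> stiefel (block_sel i *m O + X) ->
  block_stiefel (O + (block_sel i)^T *m X).
Proof.
move=> stO stX j; rewrite mulmxDr mulmxA.
have [<-|nij] := eqVneq i j; first by rewrite block_sel_id mul1mx.
by rewrite block_sel_orth 1?eq_sym// mul0mx addr0; exact: stO.
Qed.

Lemma block_stiefel_closed r : closed (@block_stiefel r).
Proof.
have -> : @block_stiefel r = \bigcap_(k in [set: 'I_m * 'I_r * 'I_r])
    (fun X : 'M[R]_(N, r) => ((block_sel k.1.1 *m X)^T *m
       (block_sel k.1.1 *m X)) k.1.2 k.2) @^-1` [set (1%:M : 'M[R]_r) k.1.2 k.2].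
  apply/seteqP; split=> [X stX [[i a] b] _ /=|X stX i]; first by rewrite stX.
  by apply/matrixP => a b; exact: (stX (i, a, b) I).
apply: closed_bigI => -[[i a] b] _; apply: preimage_closed => [X _|]; last first.
  exact: closed_eq.
have cB a' b' : continuous (fun X : 'M[R]_(N, r) => (block_sel i *m X) a' b').
  apply: mulmx_entry_continuous => *; first exact: cst_continuous.
  exact: coord_continuous.
apply: mulmx_entry_continuous => // a' b'.
rewrite (_ : (fun _ => _) = fun X => (block_sel i *m X) b' a') //.
by apply/funext => Y; rewrite mxE.
Qed.

End BlockSelection.

Section Alignment.
Context {R : realType} {m : nat} {d : 'I_m -> nat}.
Local Notation N := (\sum_(i < m) d i)%N.

Definition trace_sum (S : 'M[R]_N) r (O : 'M[R]_(N, r)) : R := mxdot O (S *m O).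

(** The objective is invariant under a common right rotation, so a global
    maximiser can be chosen with [mxdot Theta O] maximal among all global
    maximisers; this second maximality makes [Theta^T O] positive semidefinite
    and replaces a polar decomposition. *)
Lemma aligned_maximizer_exists r (S : 'M[R]_N) (Theta : 'M[R]_(N, r)) :
  block_stiefel Theta ->
  exists O, maximizer (@block_stiefel R m d r) (@trace_sum S r) O
            /\ psd (Theta^T *m O).
Proof.
move=> stTheta.
have bnd (X : 'M[R]_(N, r)) :
    block_stiefel X -> frobenius X <= Num.sqrt (m%:R * r%:R).
  by move=> stX; rewrite frobeniusE block_stiefel_mxdot// lexx.
have cfS : continuous (@trace_sum S r).
  apply: mxdot_continuous => *; first exact: coord_continuous.
  apply: mulmx_entry_continuous => *; first exact: cst_continuous.
  exact: coord_continuous.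
have clB := @block_stiefel_closed R m d r.
have [O1 [stO1 O1max]] :=
  matrix_max_attained clB bnd cfS (ex_intro _ Theta stTheta).
pose F : set 'M[R]_(N, r) :=
  @block_stiefel R m d r `&` (@trace_sum S r) @^-1` [set trace_sum S O1].
have clF : closed F.
  apply: closedI; first exact: block_stiefel_closed.
  by apply: preimage_closed => [X _|]; [exact: cfS | exact: closed_eq].
have cfT : continuous (mxdot Theta).
  apply: mxdot_continuous => *; first exact: cst_continuous.
  exact: coord_continuous.
have bndF X : F X -> frobenius X <= Num.sqrt (m%:R * r%:R) by case=> /bnd.
have FO1 : F !=set0 by exists O1; split.
have [O [[stO /= fO] Omax]] := matrix_max_attained clF bndF cfT FO1.
exists O; split; first by split=> // Y stY; rewrite fO O1max.
suff : psd (O^T *m Theta).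
  move=> psdC; rewrite -[Theta^T *m O]trmxK trmx_mul trmxK.
  by case: (psdC) => ->.
apply: orthogonal_max_psd => Q QQ.
have dotQ A : mxdot (O^T *m Theta) A = mxdot Theta (O *m A).
  by rewrite mxdot_mull trmxK.
rewrite !dotQ mulmx1; apply: Omax; split; first exact: block_stiefel_mulr.
rewrite /= -fO /trace_sum mulmxA mxdot_mulr -mulmxA (mulmx1C QQ) mulmx1 //.
Qed.

End Alignment.

Section FirstAndSecondOrder.
Context {R : realType} {m : nat} {d : 'I_m -> nat}.
Local Notation N := (\sum_(i < m) d i)%N.
Context {r : nat} {S : 'M[R]_N} {O : 'M[R]_(N, r)}.

Lemma block_variation_le0 i (X : 'M[R]_(d i, r)) : S^T = S ->
  maximizer (@block_stiefel R m d r) (@trace_sum R m d S r) O ->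
  stiefel (block_sel i *m O + X) ->
  2 * mxdot X (block_sel i *m (S *m O)) + mxdot X (submxblock S i i *m X) <= 0.
Proof.
move=> symS [stO Omax] /(block_sel_update stO)/Omax; rewrite /trace_sum.
rewrite mulmxDr mxdotDl !mxdotDr !mxdot_mull trmxK -block_sel_congr !mulmxA.
set B := block_sel i.
have -> : mxdot O (S *m B^T *m X) = mxdot X (B *m S *m O).
  by rewrite mxdotC -!mulmxA mxdot_mull symS mxdot_mull trmxK mulmxA.
rewrite -!mulmxA; lra.
Qed.

(** First-order condition: stationarity under rotations of the rows of one block
    makes [(S O)_i O_i^T] symmetric, and [stiefel_stationary] extracts from it
    the symmetric Lagrange multiplier [O_i^T (S O)_i]. *)
Lemma multiplier_sym i : S^T = S ->
  maximizer (@block_stiefel R m d r) (@trace_sum R m d S r) O ->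
  let Oi := block_sel i *m O in let Ni := block_sel i *m (S *m O) in
  (Oi^T *m Ni)^T = Oi^T *m Ni /\ Ni = Oi *m (Oi^T *m Ni).
Proof.
move=> symS Omax Oi Ni.
have stOi : Oi^T *m Oi = 1%:M by case: Omax => + _; apply.
apply: stiefel_stationary => //.
suff : (2 *: (Ni *m Oi^T))^T = 2 *: (Ni *m Oi^T).
  by rewrite linearZ /= => /(scalerI _); apply; rewrite pnatr_eq0.
apply: (@rotation_stationary_sym _ _ _ (submxblock S i i) (Oi *m Oi^T)) => K KK.
have := @block_variation_le0 i (K *m Oi) symS Omax.
rewrite -/Oi -/Ni mxdotZr => h; apply: le_trans (h _).
  rewrite [mxdot (K *m Oi) Ni]mxdot_mulr.
  by rewrite [X in _ <= _ + X]mxdot_mulr !mulmxA.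
by rewrite -[X in X + _]mul1mx -mulmxDl; apply: stiefelM.
Qed.

(** Second-order condition, from finite variations.  Reflecting the columns of
    one block, [O_i -> O_i H], leaves the diagonal term of the objective
    unchanged, so the off-diagonal part
    [O_i^T ((S O)_i - S_ii O_i)] of the multiplier must be nonnegative. *)
Lemma multiplier_ge i (v : 'cV[R]_r) : S^T = S ->
  maximizer (@block_stiefel R m d r) (@trace_sum R m d S r) O ->
  mxdot (block_sel i *m O *m v) (submxblock S i i *m (block_sel i *m O *m v)) <=
  mxdot v ((block_sel i *m O)^T *m (block_sel i *m (S *m O)) *m v).
Proof.
move=> symS Omax; set Oi := block_sel i *m O; set Ni := block_sel i *m (S *m O).
have stOi : Oi^T *m Oi = 1%:M by case: Omax => + _; apply.
have [v0|v0] := eqVneq (mxdot v v) 0.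
  by rewrite (mxdot_eq0 v0) !mulmx0 /mxdot !mulmx0.
have vgt0 : 0 < mxdot v v by rewrite lt_def v0 mxdot_ge0.
set c := 2 / mxdot v v; have cv : c * mxdot v v = 2 by rewrite divfK.
have c0 : 0 < c by rewrite divr_gt0.
have := @block_variation_le0 i (Oi *m (- c *: (v *m v^T))) symS Omax.
have stH : stiefel (block_sel i *m O + Oi *m (- c *: (v *m v^T))).
  rewrite -[X in X + _]mulmx1 -mulmxDr; apply: stiefelM => //.
  exact: householder_orthogonal.
move=> /(_ stH); rewrite -/Ni -scalemxAr -scalemxAr mxdotZl mxdotZl mxdotZr.
have -> : mxdot (Oi *m (v *m v^T)) Ni = mxdot v (Oi^T *m Ni *m v).
  by rewrite mxdot_mull mxdot_rank1.
have -> : mxdot (Oi *m (v *m v^T)) (submxblock S i i *m (Oi *m (v *m v^T)))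
    = mxdot v v * mxdot (Oi *m v) (submxblock S i i *m (Oi *m v)).
  set A := submxblock S i i; rewrite mulmxA mxdot_mulr trmxK -!mulmxA.
  rewrite (mx11_scalar (v^T *m v)) -mxdot_cv.
  by rewrite mul_mx_scalar -!scalemxAr mxdotZr.
set a := mxdot v (_ *m v); set b := mxdot _ (submxblock S i i *m _) => h.
have : 2 * (- c * (a - b)) <= 0.
  apply: le_trans h; rewrite le_eqVlt; apply/orP; left; apply/eqP.
  have -> : - c * (- c * (mxdot v v * b)) = 2 * c * b by rewrite -cv; ring.
  ring.
by rewrite pmulr_rle0// mulNr oppr_le0 pmulr_rge0// subr_ge0.
Qed.

End FirstAndSecondOrder.

(** * Polar perturbation and dual certificate *)

Section PolarPerturbation.
Context {R : realType}.

(** Perturbation of polar factors.  With [E = A - B] one has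
    [E^T E = 2 - B^T A - A^T B], and the symmetry of [L] and [P] turns
    [mxdot E (A L - B P)] into half the trace of [E^T E (L + P)]; the
    eigenvalues of [L + P] then enter only through the lower bound [k]. *)
Lemma polar_perturbation p r k (A B : 'M[R]_(p, r)) (L P : 'M[R]_r) :
  stiefel A -> stiefel B -> L^T = L -> P^T = P -> psd (L + P - k%:M) ->
  k * frobenius (A - B) <= 2 * frobenius (A *m L - B *m P).
Proof.
move=> stA stB symL symP psdLP; set E := A - B; set D := A *m L - B *m P.
have key : 2 * mxdot E D = \tr (E^T *m E *m (L + P)).
  have tA (X Y : 'M[R]_(p, r)) (Z : 'M[R]_r) :
      mxdot X (Y *m Z) = \tr (X^T *m Y *m Z).
    by rewrite /mxdot mulmxA.
  have sym (X Y : 'M[R]_(p, r)) (Z : 'M[R]_r) : Z^T = Z ->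
      \tr (X^T *m Y *m Z) = \tr (Y^T *m X *m Z).
    by move=> symZ; rewrite -mxtrace_tr !trmx_mul trmxK symZ mxtrace_mulC.
  have trG (Z : 'M[R]_r) : Z^T = Z ->
      \tr (E^T *m E *m Z) = 2 * (\tr Z - \tr (A^T *m B *m Z)).
    move=> symZ; have -> : E^T *m E = 1%:M - A^T *m B - (B^T *m A - 1%:M).
      by rewrite [X in X *m _]linearB /= mulmxBl !mulmxBr stA stB.
    by rewrite !mulmxBl !mul1mx !linearB /= (sym B A) //; ring.
  rewrite mulmxDr linearD /= !trG// /D /E mxdotBr !mxdotBl !tA stA stB !mul1mx.
  by rewrite (sym B A) //; ring.
have trE : \tr (E^T *m E) = frobenius E ^+ 2 by rewrite frobenius_sqr.
have := psd_tr_mul_ge0 (psd_gram E) psdLP.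
rewrite mulmxBr linearB /= -key mul_mx_scalar linearZ /= trE => h.
have le := mxdot_le E D; have E0 := frobenius_ge0 E.
have [->|En0] := eqVneq (frobenius E) 0.
  by rewrite mulr0 mulr_ge0 ?frobenius_ge0.
have Egt0 : 0 < frobenius E by rewrite lt_def En0.
rewrite -(ler_pM2l Egt0); nra.
Qed.

(** The vectors on which a positive semidefinite form vanishes are in its
    kernel; applied to the columns of [B]. *)
Lemma psd_congr0 n q (A : 'M[R]_n) (B : 'M[R]_(n, q)) :
  psd A -> B^T *m A *m B = 0 -> A *m B = 0.
Proof.
move=> psdA BAB; apply/matrixP => i j.
suff : A *m (B *m delta_mx j 0) = 0 :> 'cV_n.
  by rewrite mulmxA -colE => /matrixP/(_ i 0); rewrite !mxE.
apply: psd_null => //.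
by rewrite mxdot_mull !mulmxA BAB mul0mx /mxdot mulmx0 mxtrace0.
Qed.

End PolarPerturbation.

Section DualCertificate.
Context {R : realType} {m : nat} {d : 'I_m -> nat}.
Local Notation N := (\sum_(i < m) d i)%N.
Context {r : nat}.

Lemma block_stiefel_sdp_feasible (O : 'M[R]_(N, r)) :
  block_stiefel O -> sdp_feasible r (O *m O^T).
Proof.
move=> stO; split; first by rewrite -{1}(trmxK O); exact: psd_gram.
move=> i; set Oi := block_sel i *m O.
have stOi : Oi^T *m Oi = 1%:M by exact: stO.
have -> : submxblock (O *m O^T) i i = Oi *m Oi^T.
  by rewrite -block_sel_congr /Oi trmx_mul !mulmxA.
clearbody Oi; split; last by rewrite mxtrace_mulC stOi mxtrace1.
(* [1 - Oi Oi^T] is an orthogonal projection, hence a Gram matrix *)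
rewrite /loewner_le; set Q := 1%:M - _.
have symQ : Q^T = Q by rewrite linearB /= trmx1 trmx_mul trmxK.
suff -> : Q = Q^T *m Q by exact: psd_gram.
rewrite symQ /Q mulmxBl mul1mx mulmxBr mulmx1 mulmxA -(mulmxA Oi) stOi mulmx1.
by rewrite subrr subr0.
Qed.

(** A feasible [U] whose range lies in that of [O] equals [O M O^T]; the
    constraints of any single block say [M <= 1] and [tr M = r]. *)
Lemma sdp_feasible_factor (O : 'M[R]_(N, r)) (M : 'M[R]_r) (i : 'I_m) :
  block_stiefel O -> sdp_feasible r (O *m M *m O^T) -> M = 1%:M.
Proof.
move=> stO [_ /(_ i)[]]; set Oi := block_sel i *m O.
have stOi : Oi^T *m Oi = 1%:M by exact: stO.
have -> : submxblock (O *m M *m O^T) i i = Oi *m M *m Oi^T.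
  by rewrite -block_sel_congr /Oi trmx_mul !mulmxA.
clearbody Oi; move=> le1 tr_r; apply/esym/eqP; rewrite -subr_eq0; apply/eqP.
apply: psd_trace0.
  have -> : 1%:M - M = Oi^T *m (1%:M - Oi *m M *m Oi^T) *m Oi.
    rewrite mulmxBr mulmxBl mulmx1 stOi !mulmxA stOi mul1mx -mulmxA stOi mulmx1.
    by [].
  exact: psd_congr.
by rewrite linearB /= mxtrace1 -tr_r mxtrace_mulC mulmxA stOi mul1mx subrr.
Qed.

Lemma rank_block_stiefel_gram (O : 'M[R]_(N, r)) :
  (0 < m)%N -> block_stiefel O -> \rank (O *m O^T) = r.
Proof.
move=> m0 /block_stiefel_gram OO; apply/eqP; rewrite eqn_leq.
rewrite mulmx_max_rank /=.
have mn0 : m%:R != 0 :> R by rewrite pnatr_eq0 -lt0n.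
have rk : \rank (O^T *m (O *m O^T) *m O) = r.
  rewrite mulmxA OO -mulmxA OO -scalar_mxM -scalemx1.
  by rewrite mxrank_scale_nz ?mulf_neq0// mxrank1.
rewrite -[X in (X <= _)%N]rk.
by apply: leq_trans (mxrankM_maxl _ _) (mxrankM_maxr _ _).
Qed.

(** With [t] the multiplier of the constraint [tr U_ii = r] and
    [A (L - t) A^T] that of [U_ii <= 1], this is the diagonal block of the dual
    variable; it has [A] as an invariant subspace on which it acts as [L], and
    equals [t] on the orthogonal complement. *)
Definition block_multiplier p (A : 'M[R]_(p, r)) (L : 'M[R]_r) (t : R) :
    'M[R]_p :=
  t%:M + A *m (L - t%:M) *m A^T.

Lemma block_multiplier_mul p (A : 'M[R]_(p, r)) L t :
  stiefel A -> block_multiplier A L t *m A = A *m L.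
Proof.
move=> stA; rewrite mulmxDl -mulmxA stA mulmx1 mulmxBr mul_mx_scalar.
by rewrite mul_scalar_mx addrC subrK.
Qed.

Lemma block_multiplier_psd p (A : 'M[R]_(p, r)) L t :
  psd (L - t%:M) -> psd (block_multiplier A L t - t%:M).
Proof.
by move=> psdL; rewrite [X in X - _]addrC addrK -{1}(trmxK A); exact: psd_congr.
Qed.

Lemma block_multiplier_trace_le p (A : 'M[R]_(p, r)) L t (V : 'M[R]_p) :
  stiefel A -> psd (L - t%:M) -> loewner_le V 1%:M -> \tr V = r%:R ->
  \tr (block_multiplier A L t *m V) <= \tr L.
Proof.
move=> stA psdL le1 trV.
have := psd_tr_mul_le (block_multiplier_psd A psdL) le1.
rewrite mulmx1 mulmxBl mul_scalar_mx !linearB linearZ /= trV.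
rewrite linearD /= [\tr (_ *m A^T)]mxtrace_mulC mulmxA stA mul1mx linearB /=.
by rewrite !mxtrace_scalar -(mulr_natr t); lra.
Qed.

Definition dual_slack (S : 'M[R]_N) (O : 'M[R]_(N, r)) (L : 'I_m -> 'M[R]_r) t :
    'M[R]_N :=
  \sum_i (block_sel i)^T *m block_multiplier (block_sel i *m O) (L i) t *m
    block_sel i - S.

(** Complementary slackness.  The trace of [dual_slack] against a solution [U]
    is nonpositive because [O O^T] is feasible, while the slack dominates [u]
    times the orthogonal projection on the complement of the range of [O].
    Hence that projection kills [U], and [sdp_feasible_factor] identifies [U]. *)
Lemma dual_certificate (S : 'M[R]_N) (O : 'M[R]_(N, r)) L t u (U : 'M[R]_N) :
  (0 < m)%N -> S^T = S -> block_stiefel O ->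
  (forall i, block_sel i *m (S *m O) = block_sel i *m O *m L i) ->
  (forall i, psd (L i - t%:M)) ->
  (forall y : 'cV[R]_N, O^T *m y = 0 ->
     mxdot y (S *m y) <= (t - u) * mxdot y y) ->
  0 < u -> sdp_solution r S U -> U = O *m O^T.
Proof.
move=> m0 symS stO SO psdL quad u0 [Ufeas Umax].
have mn0 : m%:R != 0 :> R by rewrite pnatr_eq0 -lt0n.
have OO := block_stiefel_gram stO.
set K := dual_slack S O L t.
(* an orthogonal projection, since [O^T O = m] *)
pose Pi : 'M[R]_N := 1%:M - m%:R^-1 *: (O *m O^T).
have symPi : Pi^T = Pi by rewrite linearB linearZ /= trmx1 trmx_mul trmxK.
have OPi : O^T *m Pi = 0.
  rewrite mulmxBr mulmx1 -scalemxAr mulmxA OO mul_scalar_mx scalerA mulVf//.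
  by rewrite scale1r subrr.
have PiPi : Pi *m Pi = Pi.
  by rewrite {1}/Pi mulmxBl mul1mx -scalemxAl -mulmxA OPi mulmx0 scaler0 subr0.
have KO : K *m O = 0.
  rewrite mulmxBl mulmx_suml -[S *m O]mul1mx -block_sel_sum mulmx_suml -sumrB.
  by apply: big1 => i _; rewrite -!mulmxA SO block_multiplier_mul ?subrr.
have symB p (A : 'M[R]_(p, r)) i :
    (block_multiplier A (L i) t)^T = block_multiplier A (L i) t.
  have [] := block_multiplier_psd A (psdL i).
  by rewrite linearB /= tr_scalar_mx => /addIr.
have symK : K^T = K.
  rewrite linearB /= symS; congr (_ - _); rewrite linear_sum.
  by apply: eq_bigr => i _; rewrite /= !trmx_mul trmxK symB mulmxA.
have psdKPi : psd (K - u *: Pi).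
  apply/psdP; split; first by rewrite linearB linearZ /= symK symPi.
  move=> x; set y := Pi *m x.
  have Oy : O^T *m y = 0 by rewrite mulmxA OPi mul0mx.
  have OK : O^T *m K = 0 by rewrite -symK -trmx_mul KO trmx0.
  have xy : x = y + O *m (m%:R^-1 *: (O^T *m x)).
    by rewrite /y mulmxBl mul1mx -scalemxAl -scalemxAr mulmxA subrK.
  have Kx : mxdot x (K *m x) = mxdot y (K *m y).
    rewrite {2}xy mulmxDr [K *m (O *m _)]mulmxA KO mul0mx addr0.
    rewrite {1}xy mxdotDl mxdot_mull [O^T *m (K *m y)]mulmxA OK mul0mx.
    by rewrite [mxdot _ 0]/mxdot mulmx0 mxtrace0 addr0.
  have Pix : mxdot x (Pi *m x) = mxdot y y.
    by rewrite mxdot_mull symPi /y [Pi *m (Pi *m x)]mulmxA PiPi.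
  rewrite mulmxBl -scalemxAl mxdotBr mxdotZr Kx Pix subr_ge0.
  rewrite mulmxBl mxdotBr.
  set B := \sum_i (_ *m _ *m _).
  suff : t * mxdot y y <= mxdot y (B *m y) by have := quad y Oy; lra.
  rewrite mulmx_suml mxdot_sumr (mxdot_blocks y y) big_distrr /=.
  apply: ler_sum => i _; rewrite -!mulmxA.
  rewrite [leRHS]mxdotC [leRHS]mxdot_mull trmxK [leRHS]mxdotC.
  set yi := block_sel i *m y.
  have /psdP[_ /(_ yi)] := block_multiplier_psd (block_sel i *m O) (psdL i).
  by rewrite mulmxBl mxdotBr mul_scalar_mx mxdotZr subr_ge0.
have [psdU blockU] := Ufeas.
have trKU : \tr (K *m U) <= 0.
  rewrite mulmxBl linearB /= subr_le0.
  apply: le_trans (Umax _ (block_stiefel_sdp_feasible stO)).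
  have -> : \tr (S *m (O *m O^T)) = \sum_i \tr (L i).
    rewrite mulmxA mxtrace_mulC -/(mxdot O (S *m O)) mxdot_blocks.
    by apply: eq_bigr => i _; rewrite SO /mxdot mulmxA stO mul1mx.
  rewrite mulmx_suml linear_sum; apply: ler_sum => i _ /=.
  have [le1 tr_r] := blockU i.
  rewrite -!mulmxA mxtrace_mulC -!mulmxA [_ *m (U *m _)]mulmxA block_sel_congr.
  exact: block_multiplier_trace_le.
have trPiU : \tr (Pi *m U) = 0.
  have psdPi : psd Pi by rewrite -PiPi -{1}symPi; exact: psd_gram.
  apply/le_anti; rewrite (psd_tr_mul_ge0 psdPi psdU) andbT.
  have := psd_tr_mul_ge0 psdKPi psdU.
  rewrite mulmxBl -scalemxAl linearB linearZ /= subr_ge0 => /le_trans/(_ trKU).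
  by rewrite pmulr_rle0.
have UPi : U *m Pi = 0.
  apply: (psd_congr0 psdU); apply: psd_trace0; first exact: psd_congr.
  by rewrite symPi mxtrace_mulC mulmxA PiPi trPiU.
have UO : U = m%:R^-1 *: (U *m O *m O^T).
  apply/eqP; rewrite -subr_eq0 -[X in X - _]mulmx1 -mulmxA scalemxAr -mulmxBr.
  exact/eqP.
have [symU _] := psdU.
have OU : U = m%:R^-1 *: (O *m O^T *m U).
  by move: (congr1 trmx UO); rewrite linearZ /= !trmx_mul trmxK symU mulmxA.
pose M := m%:R^-1 *: (m%:R^-1 *: (O^T *m U *m O)).
have UM : U = O *m M *m O^T.
  by rewrite {1}UO {1}OU /M -!scalemxAr -!scalemxAl !mulmxA.
have i0 : 'I_m by exact: (Ordinal m0).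
have M1 : M = 1%:M by apply: (sdp_feasible_factor i0 stO); rewrite -UM.
by rewrite UM M1 mulmx1.
Qed.

End DualCertificate.

(** * Error estimates and tightness *)

Section Estimates.
Context {R : realType} {m : nat} {d : 'I_m -> nat}.
Local Notation N := (\sum_(i < m) d i)%N.
Context {r : nat}.

Lemma aligned_gram (A B : 'M[R]_(N, r)) :
  block_stiefel A -> block_stiefel B -> psd (A^T *m B) ->
  A^T *m B = m%:R%:M - 2^-1 *: ((B - A)^T *m (B - A)).
Proof.
move=> stA stB [sym _]; have BA : B^T *m A = A^T *m B.
  by rewrite -[RHS]sym trmx_mul trmxK.
rewrite [(B - A)^T]linearB /= mulmxBl !mulmxBr !block_stiefel_gram// BA.
by apply/matrixP => i j; rewrite !mxE; field.
Qed.

(** Comparing the objective at [O] and [Theta] gives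
    [m |E|^2 = 2 (m^2 r - m tr P) <= 2 (m^2 r - tr P^2) <= 2 <W E, O + Theta>]
    for [E = O - Theta] and [P = Theta^T O <= m]; the right-hand side is linear
    in [E]. *)
Lemma aligned_global_error (W : 'M[R]_N) (Theta O : 'M[R]_(N, r)) :
  (0 < m)%N -> W^T = W -> block_stiefel Theta -> block_stiefel O ->
  psd (Theta^T *m O) ->
  trace_sum (Theta *m Theta^T + W) Theta
    <= trace_sum (Theta *m Theta^T + W) O ->
  frobenius (O - Theta) <= 4 * opnorm W * Num.sqrt (r%:R / m%:R).
Proof.
move=> m0 symW stT stO psdP fle; set P := Theta^T *m O; set E := O - Theta.
set q := Num.sqrt _; set w := opnorm W; have w0 : 0 <= w := opnorm_ge0 W.
have mgt0 : 0 < m%:R :> R by rewrite ltr0n.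
have q0 : 0 <= q by exact: sqrtr_ge0.
have q2 : m%:R * q ^+ 2 = r%:R.
  by rewrite sqr_sqrtr ?divr_ge0 ?ler0n// mulrC divfK ?gt_eqF.
have symP : P^T = P by case: psdP.
have PE : P = m%:R%:M - 2^-1 *: (E^T *m E) := aligned_gram stT stO psdP.
have trP : \tr P = m%:R * r%:R - 2^-1 * frobenius E ^+ 2.
  by rewrite PE linearB linearZ /= mxtrace_scalar frobenius_sqr mulr_natr.
have trPP : \tr (P *m P) <= m%:R * \tr P.
  have -> : m%:R * \tr P = \tr (P *m m%:R%:M) by rewrite mul_mx_scalar linearZ.
  apply: psd_tr_mul_le => //; rewrite /loewner_le {1}PE opprB addrC subrK.
  by apply: psdZ; [rewrite invr_ge0 | exact: psd_gram].
have normE (A : 'M[R]_(N, r)) : block_stiefel A -> frobenius A = m%:R * q.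
  move=> stA; rewrite frobeniusE block_stiefel_mxdot// -q2.
  rewrite (_ : m%:R * (m%:R * q ^+ 2) = (m%:R * q) ^+ 2); last by ring.
  by rewrite sqrtr_sqr ger0_norm// mulr_ge0// ltW.
have sumE : frobenius (O + Theta) <= 2 * (m%:R * q).
  by apply: le_trans (frobeniusD _ _) _; rewrite !normE//; lra.
have obj A : trace_sum (Theta *m Theta^T + W) A
    = mxdot (Theta^T *m A) (Theta^T *m A) + mxdot A (W *m A).
  by rewrite /trace_sum mulmxDl mxdotDr mxdot_mull trmxK mulmxA.
have diffW : mxdot O (W *m O) - mxdot Theta (W *m Theta)
    = mxdot (W *m E) (O + Theta).
  rewrite /E mulmxBr mxdotBl !mxdotDr !(mxdotC (W *m _)).
  have -> : mxdot Theta (W *m O) = mxdot O (W *m Theta).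
    by rewrite mxdotC mxdot_mull symW.
  ring.
have WE : mxdot (W *m E) (O + Theta) <= w * frobenius E * (2 * (m%:R * q)).
  apply: le_trans (mxdot_le _ _) _.
  by rewrite ler_pM ?frobenius_ge0 ?frobenius_opnorm.
move: fle; rewrite !obj block_stiefel_gram// -/P.
have -> : mxdot P P = \tr (P *m P) by rewrite /mxdot symP.
have -> : mxdot (m%:R%:M : 'M[R]_r) m%:R%:M = m%:R * (m%:R * r%:R).
  by rewrite /mxdot tr_scalar_mx mul_scalar_mx linearZ /= mxtrace_scalar mulr_natr.
move=> fle; have E0 := frobenius_ge0 E.
have key : m%:R * frobenius E ^+ 2 <= m%:R * (frobenius E * (4 * w * q)).
  by move: trPP; rewrite trP; nra.
rewrite ler_pM2l// in key.
have [->|En0] := eqVneq (frobenius E) 0; first by rewrite !mulr_ge0.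
have Egt0 : 0 < frobenius E by rewrite lt_def En0.
by rewrite -(ler_pM2l Egt0) -expr2.
Qed.

Lemma max_block_frobenius_ge (Y : 'M[R]_(N, r)) i :
  frobenius (block_sel i *m Y) <= max_block_frobenius Y.
Proof.
by rewrite block_selE; apply: (le_bigmax 0 (fun i => frobenius (submxcol Y i))).
Qed.

Lemma block_perturbation_le (W : 'M[R]_N) (Theta O : 'M[R]_(N, r)) i :
  frobenius (block_sel i *m (W *m O)) <=
  max_block_frobenius (W *m Theta) + opnorm W * frobenius (O - Theta).
Proof.
rewrite -{1}(subrK Theta O) mulmxDr mulmxDr addrC.
apply: le_trans (frobeniusD _ _) _; rewrite lerD ?max_block_frobenius_ge//.
by apply: le_trans (frobenius_block_le _ _) _; exact: frobenius_opnorm.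
Qed.

Lemma frobenius_sqr_blocks_le (Y : 'M[R]_(N, r)) c :
  (forall i, frobenius (block_sel i *m Y) <= c) ->
  frobenius Y ^+ 2 <= m%:R * c ^+ 2.
Proof.
move=> Yc; rewrite frobenius_sqr mxdot_blocks.
apply: le_trans (_ : \sum_(i < m) c ^+ 2 <= _); last first.
  by rewrite sumr_const card_ord mulr_natl.
apply: ler_sum => i _; rewrite -frobenius_sqr.
by rewrite ler_pXn2r ?nnegrE ?frobenius_ge0// (le_trans _ (Yc i)) ?frobenius_ge0.
Qed.

(** The form is evaluated at [y] padded with zeros: [Theta Theta^T] contributes a
    square, and [W] at most [opnorm W] times the unchanged norm of [y]. *)
Lemma diagonal_block_ge (W : 'M[R]_N) (Theta : 'M[R]_(N, r)) i
    (y : 'cV[R]_(d i)) :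
  - (opnorm W * mxdot y y) <=
  mxdot y (submxblock (Theta *m Theta^T + W) i i *m y).
Proof.
rewrite -block_sel_congr -!mulmxA; set B := block_sel i.
have -> : mxdot y (B *m ((Theta *m Theta^T + W) *m (B^T *m y)))
    = mxdot (B^T *m y) ((Theta *m Theta^T + W) *m (B^T *m y)).
  by rewrite [RHS]mxdot_mull trmxK.
have -> : mxdot y y = mxdot (B^T *m y) (B^T *m y).
  by rewrite mxdot_mull trmxK mulmxA block_sel_id mul1mx.
rewrite mulmxDl mxdotDr -mulmxA.
have -> : mxdot (B^T *m y) (Theta *m (Theta^T *m (B^T *m y)))
    = mxdot (Theta^T *m (B^T *m y)) (Theta^T *m (B^T *m y)).
  by rewrite [RHS]mxdot_mull trmxK.
by rewrite ler_wpDl ?mxdot_ge0 ?opnorm_quad_ge.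
Qed.

Lemma aligned_gram_ge (Theta O : 'M[R]_(N, r)) (v : 'cV[R]_r) :
  block_stiefel Theta -> block_stiefel O -> psd (Theta^T *m O) ->
  (m%:R - 2^-1 * frobenius (O - Theta) ^+ 2) * mxdot v v
    <= mxdot v (Theta^T *m O *m v).
Proof.
move=> stT stO psdP; rewrite aligned_gram//; set E := O - Theta.
rewrite mulmxBl mul_scalar_mx -scalemxAl mxdotBr !mxdotZr -mulmxA.
have -> : mxdot v (E^T *m (E *m v)) = frobenius (E *m v) ^+ 2.
  by rewrite frobenius_sqr [RHS]mxdot_mull.
have : frobenius (E *m v) ^+ 2 <= frobenius E ^+ 2 * mxdot v v.
  rewrite -frobenius_sqr -exprMn ler_pXn2r ?nnegrE ?mulr_ge0 ?frobenius_ge0//.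
  exact: frobeniusM.
lra.
Qed.

(** Since [A^T A = 1], the difference between [A^T (T P + B)] and [P] is
    [A^T B - A^T (A - T) P], which is small when [A] is close to [T]: a lower
    bound on the form [P] passes to the multiplier. *)
Lemma multiplier_lower_bound p (A T B : 'M[R]_(p, r)) (P : 'M[R]_r)
    (l n a b : R) (v : 'cV[R]_r) :
  stiefel A -> frobenius (A - T) <= a -> frobenius B <= b ->
  l * mxdot v v <= mxdot v (P *m v) -> frobenius (P *m v) <= n * frobenius v ->
  (l - a * n - b) * mxdot v v <= mxdot v (A^T *m (T *m P + B) *m v).
Proof.
move=> stA ATa Bb Pl Pn.
have -> : mxdot v (A^T *m (T *m P + B) *m v)
    = mxdot v (P *m v) - mxdot (A *m v) ((A - T) *m (P *m v))
      + mxdot (A *m v) (B *m v).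
  rewrite -mulmxA -[in LHS](trmxK A) -mxdot_mull trmxK.
  rewrite mulmxDl mxdotDr; congr (_ + _); rewrite mulmxBl mxdotBr.
  by rewrite [mxdot (A *m v) (A *m _)]mxdot_mull !mulmxA stA mul1mx; ring.
have nAv : frobenius (A *m v) = frobenius v.
  by rewrite !frobeniusE mxdot_mull mulmxA stA mul1mx.
have v0 := frobenius_ge0 v.
have h1 : mxdot (A *m v) ((A - T) *m (P *m v)) <= a * n * mxdot v v.
  apply: le_trans (mxdot_le _ _) _; rewrite nAv -frobenius_sqr expr2 mulrCA.
  rewrite ler_wpM2l// (le_trans (frobeniusM _ _))// -mulrA.
  by rewrite ler_pM ?frobenius_ge0.
have h2 : - (b * mxdot v v) <= mxdot (A *m v) (B *m v).
  apply: le_trans (mxdot_ge _ _); rewrite lerN2 nAv -frobenius_sqr expr2 mulrCA.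
  by rewrite ler_wpM2l// (le_trans (frobeniusM _ _))// ler_wpM2r.
lra.
Qed.

Lemma aligned_gram_norm_le (Theta O : 'M[R]_(N, r)) (v : 'cV[R]_r) :
  block_stiefel Theta -> block_stiefel O -> psd (Theta^T *m O) ->
  frobenius (Theta^T *m O *m v)
    <= (m%:R + 2^-1 * frobenius (O - Theta) ^+ 2) * frobenius v.
Proof.
move=> stT stO psdP; rewrite aligned_gram//; set E := O - Theta.
rewrite mulmxBl mul_scalar_mx -scalemxAl; apply: le_trans (frobeniusD _ _) _.
rewrite frobeniusN !frobeniusZ !ger0_norm ?ler0n ?invr_ge0//.
rewrite [leRHS]mulrDl lerD2l -mulrA ler_pM2l ?invr_gt0//.
rewrite -mulmxA; apply: le_trans (frobeniusM _ _) _; rewrite frobenius_tr.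
rewrite expr2 -mulrA ler_wpM2l ?frobenius_ge0//; exact: frobeniusM.
Qed.

End Estimates.

(** The block errors are below 1/4, so every term quadratic in them is
    absorbed by the slack between [2 n a] and [4 n a]. *)
Lemma certificate_margin (R : realType) (n w q b a e : R) :
  0 < n -> 0 <= w -> 0 <= q -> 0 <= b -> 0 <= a ->
  4 * n * a + 2 * b + 8 * w * q + 2 * w < n -> e ^+ 2 <= n * a ^+ 2 ->
  0 < n - 2^-1 * e ^+ 2 - a * (n + 2^-1 * e ^+ 2) - b - e ^+ 2 - w.
Proof.
move=> n0 w0 q0 b0 a0 margin ea; have wq := mulr_ge0 w0 q0.
have a4 : a < 1 / 4.
  by rewrite -(ltr_pM2l n0); nra.
have e1 : e ^+ 2 <= n * a / 4 by apply: le_trans ea _; nra.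
have e2 : a * e ^+ 2 <= n * a / 4.
  apply: le_trans (_ : a * (n * a / 4) <= _); first by rewrite ler_wpM2l.
  by have := sqr_ge0 a; nra.
nra.
Qed.

Theorem theorem3p1 (R : realType) (m r : nat) (d : 'I_m -> nat)
  (hm : (1 <= m)%N) (hr : (1 <= r)%N) (hd : forall i : 'I_m, (r <= d i)%N)
  (Theta_ : forall i : 'I_m, 'M[R]_(d i, r))
  (hTheta_ : forall i : 'I_m, stiefel (Theta_ i))
  (Theta : 'M[R]_(\sum_(i < m) d i, r)) (hTheta : Theta = \mxcol_i Theta_ i)
  (W S : 'M[R]_(\sum_(i < m) d i)) (hW : W^T = W)
  (hS : S = Theta *m Theta^T + W)
  (h1 : m%:R > opnorm W * (4 * Num.sqrt r%:R + 1) + 1)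
  (h2 : m%:R >
     4 * m%:R *
       ((2 * (max_block_frobenius (W *m Theta)
              + 4 * opnorm W ^+ 2 * Num.sqrt (r%:R / m%:R)))
        / (m%:R - opnorm W * (4 * Num.sqrt r%:R + 1) - 1))
     + 2 * (max_block_frobenius (W *m Theta)
            + 4 * opnorm W ^+ 2 * Num.sqrt (r%:R / m%:R))
     + 8 * opnorm W * Num.sqrt (r%:R / m%:R)
     + 2 * opnorm W) :
  forall Uhat : 'M[R]_(\sum_(i < m) d i),
    sdp_solution r S Uhat -> rank_solution r S Uhat.
Proof.
move=> U solU.
have stT : block_stiefel Theta.
  by move=> i; rewrite block_selE hTheta mxcolK; exact: hTheta_.
have symS : S^T = S by rewrite hS linearD /= trmx_mul trmxK hW.
have [O [Omax psdP]] := aligned_maximizer_exists S stT.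
have [stO fO] := Omax.
suff UE : U = O *m O^T.
  have [Ufeas Umax] := solU; split; first split => //.
    by rewrite UE rank_block_stiefel_gram.
  by move=> V [Vfeas _]; exact: Umax.
have := fO _ stT; rewrite hS => /(aligned_global_error hm hW stT stO psdP).
move: h1 h2; set w := opnorm W; set q := Num.sqrt (_ / _); set rho := Num.sqrt _.
set b := _ + 4 * w ^+ 2 * q; set D := m%:R - _ - 1; set a := 2 * b / D.
set e := frobenius (O - Theta) => h1' h2' eq.
have mgt0 : 0 < m%:R :> R by rewrite ltr0n.
have w0 : 0 <= w := opnorm_ge0 W.
have q0 : 0 <= q := sqrtr_ge0 _.
have rho0 : 0 <= rho := sqrtr_ge0 _.
have e0 : 0 <= e := frobenius_ge0 _.
have D0 : 0 < D by rewrite /D; lra.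
have WOb i : frobenius (block_sel i *m (W *m O)) <= b.
  apply: le_trans (block_perturbation_le W Theta O i) _; rewrite -/w -/e lerD2l.
  apply: le_trans (_ : w * (4 * w * q) <= _); first by rewrite ler_wpM2l.
  by rewrite expr2; lra.
have b0 : 0 <= b := le_trans (frobenius_ge0 _) (WOb (Ordinal hm)).
have a0 : 0 <= a by rewrite /a divr_ge0 ?mulr_ge0// ltW.
(* this makes [D] a lower bound for the sum of the least eigenvalues of [L i], which
   is at least [- w], and of [P], which is at least [m - e ^ 2 / 2] *)
have e_rho : e ^+ 2 <= 4 * w * rho.
  have rq : m%:R * q ^+ 2 = rho ^+ 2.
    by rewrite !sqr_sqrtr ?divr_ge0 ?ler0n// mulrC divfK ?gt_eqF.
  have eq2 : e ^+ 2 <= (4 * w * q) ^+ 2.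
    by rewrite ler_pXn2r ?nnegrE ?mulr_ge0.
  have wrho := mulr_ge0 w0 rho0.
  rewrite -(ler_pM2l mgt0); apply: le_trans (_ : m%:R * (4 * w * q) ^+ 2 <= _).
    by rewrite ler_pM2l.
  rewrite (_ : _ * _ = (4 * w * rho) * (4 * w * rho)); last first.
    by rewrite !exprMn mulrCA rq; ring.
  by rewrite mulrC ler_wpM2r ?mulr_ge0//; lra.
pose P := Theta^T *m O; pose T i := block_sel i *m Theta.
pose A i := block_sel i *m O; pose L i := (A i)^T *m (block_sel i *m (S *m O)).
have SOi i : block_sel i *m (S *m O) = T i *m P + block_sel i *m (W *m O).
  by rewrite hS mulmxDl mulmxDr /T /P !mulmxA.
have [symL SOL] : (forall i, (L i)^T = L i) /\
    (forall i, block_sel i *m (S *m O) = A i *m L i).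
  by split=> i; have [] := multiplier_sym i symS Omax.
have Ea i : frobenius (A i - T i) <= a.
  rewrite /a ler_pdivlMr// mulrC.
  apply: le_trans (_ : 2 * frobenius (A i *m L i - T i *m P) <= _).
    apply: polar_perturbation;
      [exact: stO | exact: stT | exact: symL | by case: psdP|].
    apply: psd_scalar => [|v]; first by rewrite linearD /= symL; case: psdP => ->.
    rewrite mulmxDl mxdotDr.
    have := multiplier_ge i v symS Omax; rewrite -/(A i) -/(L i).
    have := diagonal_block_ge W Theta (A i *m v); rewrite -hS.
    have -> : mxdot (A i *m v) (A i *m v) = mxdot v v.
      by rewrite mxdot_mull mulmxA stO mul1mx.
    have := aligned_gram_ge v stT stO psdP; rewrite -/P -/e -/w.
    have := mxdot_ge0 v; rewrite /D; nra.
  by rewrite -SOL SOi addrC addKr ler_pM2l.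
have ea : e ^+ 2 <= m%:R * a ^+ 2.
  by apply: frobenius_sqr_blocks_le => i; rewrite mulmxBr.
(* with the block errors controlled, the lower bound [- w] on the multipliers
   improves to the following one *)
pose t := m%:R - 2^-1 * e ^+ 2 - a * (m%:R + 2^-1 * e ^+ 2) - b.
apply: (@dual_certificate _ _ _ _ S O L t (t - e ^+ 2 - w)) => //.
- move=> i; apply: psd_scalar => // v; rewrite /L SOi.
  apply: multiplier_lower_bound (stO i) (Ea i) (WOb i) _ _.
  + exact: aligned_gram_ge.
  + exact: aligned_gram_norm_le.
- move=> y Oy; rewrite hS mulmxDl mxdotDr -mulmxA.
  have -> : mxdot y (Theta *m (Theta^T *m y)) = frobenius (Theta^T *m y) ^+ 2.
    by rewrite frobenius_sqr [RHS]mxdot_mull trmxK.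
  (* on the orthogonal of the range of [O] the signal part of [S] is as small as
     [O - Theta] *)
  have -> : Theta^T *m y = - ((O - Theta)^T *m y).
    by rewrite linearB /= mulmxBl Oy sub0r opprK.
  rewrite frobeniusN.
  have : frobenius ((O - Theta)^T *m y) ^+ 2 <= e ^+ 2 * mxdot y y.
    rewrite -frobenius_sqr -exprMn ler_pXn2r ?nnegrE ?mulr_ge0 ?frobenius_ge0//.
    by rewrite /e -(frobenius_tr (O - Theta)) frobeniusM.
  have := opnorm_quad_le W y; rewrite -/w; lra.
- by apply: certificate_margin q0 b0 a0 _ ea.
Qed.
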